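(* Let $\Omega_L=(-1,0)\times(-1,1)$ and $\Omega_R=(0,1)\times(-1,1)$ in $\mathbb{R}^2$. For measurable $A\subset\Omega_L$, $B\subset\Omega_R$ with $\mathrm{dist}(A,B)>0$ let $$\mathcal{I}(A,B)=\iint_{(x,y)\in A\times B}K_{|x_1-y_1|}(x_2-y_2)\,dx\,dy,\qquad K_r(s)=\frac{s}{(r^2+s^2)^2},$$ and let $$\mathcal{U}(\varepsilon)=\sup\big\{|\mathcal{I}(A,B)|:\ \mathrm{dist}(A,B)\ge\varepsilon,\ A\subset\Omega_L,\ B\subset\Omega_R\big\}.$$ Then for $0<\varepsilon<1/2$, $$\mathcal{U}(\varepsilon)\approx\log(1/\varepsilon),$$ that is, there are constants $0<c\le C<\infty$ such that $c\log(1/\varepsilon)\le\mathcal{U}(\varepsilon)\le C\log(1/\varepsilon)$ for all $\varepsilon\in(0,1/2)$.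
   Context: $\mathrm{dist}(A,B)=\inf\{|x-y|:x\in A,\ y\in B\}$ is the Euclidean distance in $\mathbb{R}^2$; the supremum is over measurable sets $A$, $B$; points are written $x=(x_1,x_2)$, $y=(y_1,y_2)$. *)

(* Defs.v *)
From HB Require Import structures.
From mathcomp Require Import all_boot all_order all_algebra.
From mathcomp Require Import all_classical all_reals all_analysis.

Set Implicit Arguments.
Unset Strict Implicit.
Unset Printing Implicit Defensive.

Import Order.TTheory GRing.Theory Num.Theory.
Import numFieldNormedType.Exports.

Local Open Scope classical_set_scope.
Local Open Scope ring_scope.

(* In the library, [measurable] on R and on R * R means Borel.  The type [plane]
   is R * R with the Lebesgue sigma-algebra instead (Caratheodory-measurable
   sets of the outer measure induced by the product measure), and [lebesgue2]
   is the complete Lebesgue measure on it. *)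
Definition borel_lebesgue2 (R : realType) :
    set (measurableTypeR R * measurableTypeR R)%type -> \bar R :=
  (@lebesgue_measure R \x @lebesgue_measure R)%E.
HB.instance Definition _ (R : realType) := Measure.on (@borel_lebesgue2 R).

Lemma borel_lebesgue2_sigma_finite (R : realType) :
  sigma_finite setT (@borel_lebesgue2 R).
Proof.
have /sigma_finiteP[F [TF ndF Foo]] := sigma_finiteT (@lebesgue_measure R).
exists (fun n => F n `*` F n).
  rewrite -setXTT {1 2}TF predeqE => -[x y]; split.
    move=> [/= [n _ Fnx] [k _ Fky]]; exists (maxn n k) => //; split.
    - by move: x Fnx; exact/subsetPset/ndF/leq_maxl.
    - by move: y Fky; exact/subsetPset/ndF/leq_maxr.
  by move=> [n _ []/= ? ?]; split; exists n.
move=> k; have [? ?] := Foo k; split; first exact: measurableX.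
by rewrite /borel_lebesgue2 product_measure1E// lte_mul_pinfty// ge0_fin_numE.
Qed.

Definition plane (R : realType) : Type :=
  (measurableTypeR R * measurableTypeR R)%type.
HB.instance Definition _ (R : realType) := Pointed.on (plane R).

Definition outer_lebesgue2 (R : realType) : set (plane R) -> \bar R :=
  mu_ext (@borel_lebesgue2 R).
HB.instance Definition _ (R : realType) :=
  isOuterMeasure.Build R (plane R) (@outer_lebesgue2 R)
    (outer_measure0 (mu_ext (@borel_lebesgue2 R)))
    (outer_measure_ge0 (mu_ext (@borel_lebesgue2 R)))
    (le_outer_measure (mu_ext (@borel_lebesgue2 R)))
    (outer_measure_sigma_subadditive (mu_ext (@borel_lebesgue2 R))).

Definition plane_display : measure_display. Proof. exact. Qed.

HB.instance Definition _ (R : realType) :=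
  @isMeasurable.Build plane_display (plane R)
    (@outer_lebesgue2 R).-caratheodory
    (caratheodory_measurable_set0 _)
    (@caratheodory_measurable_setC _ _ _)
    (@caratheodory_measurable_bigcup _ _ _).

Definition lebesgue2 (R : realType) : set (plane R) -> \bar R :=
  @outer_lebesgue2 R.

HB.instance Definition _ (R : realType) :=
  isMeasure.Build _ (plane R) R (@lebesgue2 R)
    (@caratheodory_measure0 _ _ (@outer_lebesgue2 R))
    (@caratheodory_measure_ge0 _ _ (@outer_lebesgue2 R))
    (@caratheodory_measure_sigma_additive _ _ (@outer_lebesgue2 R)).

Lemma borel_measurable_plane (R : realType)
    (A : set (measurableTypeR R * measurableTypeR R)%type) :
  measurable A -> measurable (A : set (plane R)).
Proof.
by move=> mA; exact: (caratheodory_measurable_mu_ext (@borel_lebesgue2 R)).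
Qed.

Lemma lebesgue2_borelE (R : realType)
    (A : set (measurableTypeR R * measurableTypeR R)%type) :
  measurable A -> lebesgue2 (A : set (plane R)) = borel_lebesgue2 A.
Proof. by move=> mA; exact: (measurable_mu_extE (@borel_lebesgue2 R)). Qed.

Lemma lebesgue2_complete (R : realType) : measure_is_complete (@lebesgue2 R).
Proof.
move=> B [A [mA muA BA]].
by apply: (@measure_is_complete_caratheodory _ _ (@outer_lebesgue2 R)); exists A.
Qed.

Lemma lebesgue2_sigma_finite (R : realType) :
  sigma_finite setT (@lebesgue2 R).
Proof.
have [S TS mS] := @borel_lebesgue2_sigma_finite R.
exists S => // i; have [mSi Sioo] := mS i.
by split; [exact: borel_measurable_plane | rewrite lebesgue2_borelE].
Qed.

HB.instance Definition _ (R : realType) :=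
  Measure_isSigmaFinite.Build _ _ _ (@lebesgue2 R)
    (@lebesgue2_sigma_finite R).

Section definitions.
Context {R : realType}.
Implicit Types (x y : plane R) (A B : set (plane R)) (r s eps : R).

Definition OmegaL : set (plane R) := `]-1, 0[ `*` `]-1, 1[.
Definition OmegaR : set (plane R) := `]0, 1[ `*` `]-1, 1[.

(* The library's norm on a product is the max norm, hence the explicit
   Euclidean distance. *)
Definition edist2 x y : R :=
  Num.sqrt ((x.1 - y.1) ^+ 2 + (x.2 - y.2) ^+ 2).

(* Equal to +oo when A or B is empty. *)
Definition set_dist A B : \bar R :=
  ereal_inf [set (edist2 z.1 z.2)%:E | z in A `*` B].

Definition kernelK r s : R := s / (r ^+ 2 + s ^+ 2) ^+ 2.

(* When the distance of A and B is positive the kernel is bounded on A `*` B,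
   so for A, B as in [maxinteraction] this extended-real integral is finite. *)
Definition interaction A B : \bar R :=
  (\int[@lebesgue2 R \x @lebesgue2 R]_(z in A `*` B)
     (kernelK `|z.1.1 - z.2.1| (z.1.2 - z.2.2))%:E)%E.

Definition maxinteraction eps : \bar R :=
  ereal_sup [set u | exists A B : set (plane R),
    [/\ measurable A /\ measurable B, A `<=` OmegaL, B `<=` OmegaR,
        (eps%:E <= set_dist A B)%E & u = `|interaction A B|%E]].

End definitions.

(* Main.v *)
(* Upper bound: on pairs at distance at least eps, with r = |x_1 - y_1| and
   s = x_2 - y_2, the kernel is at most a constant times
   1 / (p (p^2 + s^2)), p = r + eps.  Integrating in y_2, y_1, x_2, x_1
   successively gives orders 1/p^2, 1/(eps - x_1), 1/(eps - x_1) and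
   log(1/eps).

   Lower bound: in the layers |x_1|, y_1 ~ d = 2^-(k+1), eps <= 2d, put about
   1/d pairs of rectangles of size ~ d, the left one lying slightly higher than
   the right one.  Each pair contributes at least a constant times d, hence
   each of the ~ log(1/eps) scales contributes a constant.  The interactions
   between different pairs are not controlled; instead a choice of signs makes
   their total nonnegative, and the signed sum splits into four interactions of
   unions of rectangles, so one of these four is of order log(1/eps). *)

Require Import Defs.
From mathcomp Require Import all_boot all_order all_algebra.
From mathcomp Require Import all_classical all_reals all_analysis.
From mathcomp Require Import measurable_realfun ring lra.
Import Order.TTheory GRing.Theory Num.Theory.
Import numFieldNormedType.Exports.
Local Open Scope classical_set_scope.
Local Open Scope ring_scope.

(** * Tonelli on product domains and iterated integrals on the plane *)

Lemma ge0_integral_setX d1 d2 (T1 : measurableType d1) (T2 : measurableType d2)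
    (R : realType) (m1 : {sigma_finite_measure set T1 -> \bar R})
    (m2 : {sigma_finite_measure set T2 -> \bar R}) (A : set T1) (B : set T2)
    (f : T1 * T2 -> \bar R) :
  measurable A -> measurable B -> measurable_fun setT f ->
  (forall z, 0 <= f z)%E ->
  (\int[m1 \x m2]_(z in A `*` B) f z =
   \int[m1]_(x in A) \int[m2]_(y in B) f (x, y))%E.
Proof.
move=> mA mB mf f0; have mAB : measurable (A `*` B) by exact: measurableX.
rewrite integral_mkcond fubini_tonelli1.
- rewrite [RHS]integral_mkcond; apply: eq_integral => x _.
  rewrite /fubini_F patchE; case: ifPn => xA.
    rewrite [RHS]integral_mkcond; apply: eq_integral => y _.
    by rewrite !patchE in_setX xA.
  by rewrite integral0_eq// => y _; rewrite patchE in_setX (negbTE xA).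
- by apply/measurable_restrict => //; rewrite setTI; exact: measurable_funTS.
- by move=> z; exact: erestrict_ge0.
Qed.

Lemma measurable_plane_id (R : realType) :
  measurable_fun setT
    (fun x : plane R => (x : measurableTypeR R * measurableTypeR R)%type).
Proof. by move=> _ Y mY; rewrite setTI; exact: borel_measurable_plane. Qed.

(** The identity from [plane] to the Borel product is measurable and pushes [lebesgue2] forward to
    the Borel product measure, so a Borel integrand can be integrated one coordinate at a time. *)
Lemma ge0_integral_lebesgue2 (R : realType) (A B : set (measurableTypeR R))
    (f : measurableTypeR R * measurableTypeR R -> \bar R) :
  measurable A -> measurable B -> measurable_fun setT f ->
  (forall z, 0 <= f z)%E ->
  (\int[@lebesgue2 R]_(x in A `*` B) f x =
   \int[lebesgue_measure]_(s in A) \int[lebesgue_measure]_(t in B) f (s, t))%E.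
Proof.
move=> mA mB mf f0; have mAB : measurable (A `*` B) by exact: measurableX.
rewrite -ge0_integral_setX//.
have /esym := ge0_integral_pushforward (measurable_plane_id R) (@lebesgue2 R)
  mAB (measurable_funTS mf) (fun z _ => f0 z).
move=> h; apply: (eq_trans h); apply: eq_measure_integral => /=.
  exact: measurable_plane_id.
by move=> ? C mC _; exact: lebesgue2_borelE.
Qed.

(** * Integrals in one real variable *)

Lemma integral_itvoo_FTC (R : realType) (f F : R -> R) (a b : R) :
  a < b -> (forall x, x \in `[a, b] -> {for x, continuous f}) ->
  (forall x, x \in `[a, b] -> is_derive x 1 F (f x)) ->
  (\int[lebesgue_measure]_(x in `]a, b[) (f x)%:E = (F b - F a)%:E)%E.
Proof.
move=> ab cf dF.
have cw : {within `[a, b], continuous f}.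
  apply: continuous_in_subspaceT => x; rewrite inE; exact: cf.
have cF x : x \in `[a, b] -> {for x, continuous F}.
  move=> /dF d; apply: differentiable_continuous.
  by apply/derivable1_diffP; exact: ex_derive.
rewrite EFinB -(@continuous_FTC2 _ f F)//.
- rewrite [RHS]integral_itv_bndoo//.
  apply/measurable_EFinP.
  apply: measurable_funS (subspace_continuous_measurable_fun _ cw) => //.
  exact: subset_itvW.
- split.
  + move=> x xab; have := dF x (subset_itvW _ _ (lexx a) (lexx b) xab).
    by move=> d; exact: ex_derive.
  + by apply: cvg_at_right_filter; apply: cF; rewrite in_itv/= lexx ltW.
  + by apply: cvg_at_left_filter; apply: cF; rewrite in_itv/= lexx ltW.
- move=> x xab; have := dF x (subset_itvW _ _ (lexx a) (lexx b) xab).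
  by move=> d; rewrite derive1E derive_val.
Qed.

(** A primitive is [atan ((t - a) / p) / p ^+ 2], and the range of [atan] has length [pi]; hence a
    bound uniform in [a]. *)
Lemma integral_atan_le (R : realType) (p a : R) : 0 < p ->
  (\int[lebesgue_measure]_(t in `](-1)%R, 1%R[) ((p * (p ^+ 2 + (a - t) ^+ 2))^-1)%:E
   <= (pi * (p ^+ 2)^-1)%:E)%E.
Proof.
move=> p0; have pn0 : p != 0 by rewrite gt_eqF.
have D0 t : p * (p ^+ 2 + (a - t) ^+ 2) != 0.
  by rewrite mulf_neq0// gt_eqF// ltr_pwDl ?sqr_ge0// exprn_gt0.
pose F := fun t => atan ((t - a) / p) / p ^+ 2 : R.
rewrite [leLHS](_ : _ = (F 1 - F (-1))%:E)%E; last apply: integral_itvoo_FTC.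
- rewrite lee_fin /F -mulrBl ler_wpM2r ?invr_ge0 ?sqr_ge0//.
  have := atan_ltpi2 ((1 - a) / p); have := atan_gtNpi2 ((-1 - a) / p).
  by move=> h1 h2; lra.
- by lra.
- move=> t _; apply: cvgV => //; apply: cvgM; first exact: cvg_cst.
  apply: cvgD; first exact: cvg_cst.
  by apply: cvgM; (apply: cvgB; [exact: cvg_cst|exact: cvg_id]).
- move=> t _; apply: is_derive_eq.
  rewrite /GRing.scale/=.
  have Dn : p ^+ 2 + (a - t) ^+ 2 != 0.
    by have := D0 t; rewrite mulf_eq0 negb_or => /andP[].
  have -> : 1 + ((t - a) / p) ^+ 2 = (p ^+ 2 + (a - t) ^+ 2) / p ^+ 2.
    by field.
  by field; rewrite pn0 Dn.
Qed.

Lemma integral_inv_sqr_le (R : realType) (q : R) : 0 < q ->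
  (\int[lebesgue_measure]_(u in `]0%R, 1%R[) (((q + u) ^+ 2)^-1)%:E <= (q^-1)%:E)%E.
Proof.
move=> q0.
have D0 u : u \in `[0, 1] -> q + u != 0.
  by rewrite in_itv/= => /andP[u0 _]; rewrite gt_eqF// ltr_wpDr.
pose F := fun u => - (q + u)^-1 : R.
rewrite [leLHS](_ : _ = (F 1 - F 0)%:E)%E; last apply: integral_itvoo_FTC.
- by rewrite lee_fin /F addr0 opprK gerDr oppr_le0 invr_ge0; lra.
- by lra.
- move=> u u01; apply: cvgV; first by rewrite expf_neq0// D0.
  by apply: cvgM; (apply: cvgD; [exact: cvg_cst|exact: cvg_id]).
- move=> u u01; have := D0 u u01 => h; apply: is_derive_eq.
  by rewrite /GRing.scale/=; field.
Qed.

Lemma integral_inv_le (R : realType) (eps : R) : 0 < eps -> eps < 1 / 2 ->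
  (\int[lebesgue_measure]_(t in `](-1)%R, 0%R[) ((eps - t)^-1)%:E
   <= (2 * ln (1 / eps))%:E)%E.
Proof.
move=> e0 e12.
have D0 t : t \in `[-1, 0] -> 0 < eps - t.
  by rewrite in_itv/= => /andP[_ t0]; lra.
pose F := fun t => - ln (eps - t) : R.
rewrite [leLHS](_ : _ = (F 0 - F (-1))%:E)%E; last apply: integral_itvoo_FTC.
(* As [eps < 1 / 2], [(eps + 1) * eps <= 1]; the term [ln (eps + 1)] is thus absorbed by doubling
   [ln (1 / eps)]. *)
- have h1 : ln (eps + 1) <= ln (1 / eps).
    rewrite ler_ln ?posrE ?divr_gt0//; last by lra.
    by rewrite ler_pdivlMr//; nra.
  have h2 : ln (1 / eps) = - ln eps by rewrite div1r lnV ?posrE.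
  by rewrite lee_fin /F subr0 !opprK; lra.
- by lra.
- move=> t tI; apply: cvgV; first by rewrite gt_eqF// D0.
  by apply: cvgB; [exact: cvg_cst|exact: cvg_id].
- move=> t tI; have h := D0 t tI.
  have hd := is_derive1_ln h.
  apply: is_derive_eq.
  by rewrite /GRing.scale/=; field; rewrite gt_eqF.
Qed.

(** * Pointwise majorant of the kernel *)

(** Replacing [r] by [eps + r] removes the singularity, so that this majorant can be integrated over
    all of [OmegaL] and [OmegaR], with no distance condition left. *)
Definition kernel_bound {R : realType} (eps r s : R) : R :=
  25 / 2 * ((eps + r) * ((eps + r) ^+ 2 + s ^+ 2))^-1.

Lemma kernel_bound_ge0 (R : realType) (eps r s : R) : 0 < eps -> 0 <= r ->
  0 <= kernel_bound eps r s.
Proof.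
move=> e0 r0; have p0 : 0 <= eps + r by rewrite addr_ge0// ltW.
by rewrite mulr_ge0 ?divr_ge0// invr_ge0 mulr_ge0// addr_ge0 ?sqr_ge0.
Qed.

(** Two inequalities combine: [D <= 5 * rho], where the distance condition enters, and
    [2 * p * |s| <= D], the arithmetic-geometric mean inequality. Together they give
    [|s| / rho ^+ 2 <= 25 / (2 * p * D)]. *)
Lemma kernelK_le (R : realType) (eps r s : R) : 0 < eps -> 0 <= r ->
  eps <= Num.sqrt (r ^+ 2 + s ^+ 2) ->
  `|kernelK r s| <= kernel_bound eps r s.
Proof.
move=> e0 r0 ers; rewrite /kernelK /kernel_bound.
have hs : eps ^+ 2 <= r ^+ 2 + s ^+ 2.
  rewrite -(@sqr_sqrtr _ (r ^+ 2 + s ^+ 2)) ?addr_ge0 ?sqr_ge0//.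
  by rewrite ler_pXn2r// nnegrE// ?sqrtr_ge0// ltW.
set rho := r ^+ 2 + s ^+ 2 in hs *; set p := eps + r.
have rho0 : 0 < rho by rewrite (lt_le_trans _ hs)// exprn_gt0.
have p0 : 0 < p by rewrite ltr_pwDl.
set D := p ^+ 2 + s ^+ 2.
have D0 : 0 < D by rewrite ltr_pwDl ?exprn_gt0 ?sqr_ge0.
have DR : D <= 5 * rho.
  by rewrite /D /p /rho in hs *; have := sqr_ge0 (eps - r); nra.
rewrite normrM normfV [`|rho ^+ 2|]ger0_norm ?sqr_ge0//.
rewrite ler_pdivrMr ?exprn_gt0//.
have h1 : `|s| * (2 * p) <= D.
  have := sqr_ge0 (p - `|s|); rewrite /D -(real_normK (num_real s)).
  by nra.
have h2 : D ^+ 2 <= 25 * rho ^+ 2.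
  have -> : 25 * rho ^+ 2 = (5 * rho) ^+ 2 by ring.
  by rewrite ler_pXn2r// nnegrE; lra.
have -> : 25 / 2 * (p * D)^-1 * rho ^+ 2 = (25 * rho ^+ 2) / (2 * p * D).
  by field; rewrite !gt_eqF.
rewrite ler_pdivlMr ?mulr_gt0//; apply: le_trans h2.
by rewrite mulrA expr2 ler_pM2r.
Qed.

(* Measurability is not needed: the integral of a nonnegative function is a
   supremum over the simple functions below it. *)
Lemma le_integral_ge0 d (T : measurableType d) (R : realType)
    (mu : {measure set T -> \bar R}) (D : set T) (f g : T -> \bar R) :
  (forall x, D x -> 0 <= f x)%E -> (forall x, D x -> f x <= g x)%E ->
  (\int[mu]_(x in D) f x <= \int[mu]_(x in D) g x)%E.
Proof.
move=> f0 fg; rewrite !(integral_mkcond D).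
have f0' x : (0 <= (f \_ D) x)%E by exact: erestrict_ge0.
have fg' x : ((f \_ D) x <= (g \_ D) x)%E.
  by rewrite !patchE; case: ifPn => // /[!inE]; exact: fg.
rewrite !ge0_integralTE//; last by move=> x; rewrite (le_trans (f0' x)).
apply: ereal_sup_le => _ [h /= hf <-]; exists h => //= x.
exact: le_trans (hf x) (fg' x).
Qed.

(** * Measurability of the kernel and of the two domains *)

(** Inversion is written as [x] times a real power of [x ^+ 2], a product of measurable functions;
    at 0 the two agree because the inverse of 0 is 0 by convention. *)
Lemma measurable_inv (R : realType) :
  measurable_fun [set: R] (GRing.inv : R -> R).
Proof.
rewrite (_ : GRing.inv = fun x : R => x * (x ^+ 2) `^ (-1)).
  apply: measurable_funM => //.
  apply: (@measurableT_comp _ _ _ _ _ _ (fun y : R => y `^ (-1))) => //.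
apply/funext => x; rewrite powR_inv1 ?sqr_ge0//.
have [->|x0] := eqVneq x 0; first by rewrite invr0 mul0r.
by rewrite expr2 invfM mulrA mulfV// mul1r.
Qed.

Lemma measurable_funV d (T : measurableType d) (R : realType) (D : set T)
    (f : T -> R) : measurable_fun D f -> measurable_fun D (fun x => (f x)^-1).
Proof. exact: (measurableT_comp (@measurable_inv R)). Qed.

Lemma measurable_plane_fst (R : realType) :
  measurable_fun setT (fun x : plane R => x.1 : R).
Proof. exact: (measurableT_comp measurable_fst (measurable_plane_id R)). Qed.

Lemma measurable_plane_snd (R : realType) :
  measurable_fun setT (fun x : plane R => x.2 : R).
Proof. exact: (measurableT_comp measurable_snd (measurable_plane_id R)). Qed.

Lemma measurable_pair_sub_fst (R : realType) :
  measurable_fun setT (fun z : plane R * plane R => z.1.1 - z.2.1 : R).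
Proof.
apply: measurable_funB.
  exact: (measurableT_comp (measurable_plane_fst R) measurable_fst).
exact: (measurableT_comp (measurable_plane_fst R) measurable_snd).
Qed.

Lemma measurable_pair_sub_snd (R : realType) :
  measurable_fun setT (fun z : plane R * plane R => z.1.2 - z.2.2 : R).
Proof.
apply: measurable_funB.
  exact: (measurableT_comp (measurable_plane_snd R) measurable_fst).
exact: (measurableT_comp (measurable_plane_snd R) measurable_snd).
Qed.

Lemma measurable_kernelK (R : realType) :
  measurable_fun setT (fun z : plane R * plane R =>
    kernelK `|z.1.1 - z.2.1| (z.1.2 - z.2.2)).
Proof.
apply: measurable_funM; first exact: measurable_pair_sub_snd.
apply: measurable_funV; apply: measurable_funX; apply: measurable_funD.
- apply: measurable_funX.
  apply: (@measurableT_comp _ _ _ _ _ _ (@Num.norm _ R)) => //.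
  exact: measurable_pair_sub_fst.
- by apply: measurable_funX; exact: measurable_pair_sub_snd.
Qed.

Lemma measurable_OmegaL (R : realType) : measurable (@OmegaL R).
Proof. by apply: borel_measurable_plane; exact: measurableX. Qed.

Lemma measurable_OmegaR (R : realType) : measurable (@OmegaR R).
Proof. by apply: borel_measurable_plane; exact: measurableX. Qed.

(** * The upper bound *)

(** With [p = eps - x.1 + u], where [u] is the first coordinate of [y], [integral_atan_le] disposes
    of the second coordinate at the cost of [pi / p ^+ 2], and [integral_inv_sqr_le] then disposes
    of [u]. *)
Lemma integral_majorant_OmegaR (R : realType) (eps : R) (x : plane R) :
  0 < eps -> x.1 < 0 ->
  (\int[@lebesgue2 R]_(y in OmegaR) 
     (kernel_bound eps `|x.1 - y.1| (x.2 - y.2))%:E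
   <= (25 / 2 * pi * (eps - x.1)^-1)%:E)%E.
Proof.
move=> e0 x0.
pose g (y : measurableTypeR R * measurableTypeR R) : \bar R :=
  (kernel_bound eps `|x.1 - y.1| (x.2 - y.2))%:E.
rewrite (@ge0_integral_lebesgue2 R _ _ g)//; last 2 first.
- have m1 : measurable_fun setT (fun y : measurableTypeR R * measurableTypeR R =>
      eps + `|x.1 - y.1| : R).
    apply: measurable_funD => //.
    apply: (@measurableT_comp _ _ _ _ _ _ (@Num.norm _ R)) => //.
    by apply: measurable_funB => //; exact: measurable_fst.
  apply/measurable_EFinP; apply: measurable_funM => //; apply: measurable_funV.
  apply: measurable_funM => //; apply: measurable_funD; apply: measurable_funX => //.
  by apply: measurable_funB => //; exact: measurable_snd.
- by move=> y; rewrite lee_fin kernel_bound_ge0.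
have q0 : 0 < eps - x.1 by lra.
apply: (@le_trans _ _ (\int[lebesgue_measure]_(u in `]0%R, 1%R[)
    ((25 / 2 * pi)%:E * (((eps - x.1 + u) ^+ 2)^-1)%:E))%E).
  apply: le_integral_ge0 => u.
    by move=> _; apply: integral_ge0 => t _; rewrite lee_fin kernel_bound_ge0.
  rewrite /= in_itv/= => /andP[u0 u1]; rewrite /g/= /kernel_bound.
  under eq_integral do rewrite EFinM.
  have -> : `|x.1 - u| = u - x.1 by rewrite ler0_norm ?opprB//; lra.
  have -> : eps + (u - x.1) = eps - x.1 + u by ring.
  have p0 : 0 < eps - x.1 + u by lra.
  rewrite ge0_integralZl_EFin//.
  - rewrite [(25 / 2 * pi)%:E]EFinM -muleA.
    by apply: lee_wpmul2l; [rewrite lee_fin divr_ge0|exact: integral_atan_le].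
  - move=> t _; rewrite lee_fin invr_ge0 mulr_ge0 ?(ltW p0)//.
    by rewrite addr_ge0 ?sqr_ge0.
  - apply/measurable_EFinP/measurable_funV/measurable_funM => //.
    by apply: measurable_funD => //; apply/measurable_funX/measurable_funB.
rewrite ge0_integralZl_EFin//.
- rewrite [leRHS]EFinM; apply: lee_wpmul2l; last exact: integral_inv_sqr_le.
  by rewrite lee_fin mulr_ge0 ?divr_ge0 ?pi_ge0.
- by move=> u _; rewrite lee_fin invr_ge0 sqr_ge0.
- by apply/measurable_EFinP/measurable_funV/measurable_funX/measurable_funD.
- by rewrite mulr_ge0 ?divr_ge0 ?pi_ge0.
Qed.

(** The constant 50 is the 25 / 2 of the majorant, times the length 2 of the range of the second
    coordinate of [x], times the 2 of [integral_inv_le]. *)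
Lemma integral_majorant (R : realType) (eps : R) : 0 < eps -> eps < 1 / 2 ->
  (\int[@lebesgue2 R \x @lebesgue2 R]_(z in OmegaL `*` OmegaR) 
     (kernel_bound eps `|z.1.1 - z.2.1| (z.1.2 - z.2.2))%:E
   <= (50 * pi * ln (1 / eps))%:E)%E.
Proof.
move=> e0 e12.
rewrite ge0_integral_setX; last 4 first.
- exact: measurable_OmegaL.
- exact: measurable_OmegaR.
- have m1 : measurable_fun setT (fun z : plane R * plane R =>
      eps + `|z.1.1 - z.2.1| : R).
    apply: measurable_funD => //.
    apply: (@measurableT_comp _ _ _ _ _ _ (@Num.norm _ R)) => //.
    exact: measurable_pair_sub_fst.
  apply/measurable_EFinP; apply: measurable_funM => //; apply: measurable_funV.
  apply: measurable_funM => //; apply: measurable_funD; apply: measurable_funX => //.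
  exact: measurable_pair_sub_snd.
- by move=> z; rewrite lee_fin kernel_bound_ge0.
have k0 : 0 <= 25 / 2 * pi :> R by rewrite mulr_ge0 ?divr_ge0 ?pi_ge0.
(* Writing [|x.1|] for [- x.1] keeps [g] nonnegative on the whole plane, as [ge0_integral_lebesgue2]
   requires. *)
pose g (x : measurableTypeR R * measurableTypeR R) : \bar R :=
  (25 / 2 * pi * (eps + `|x.1|)^-1)%:E.
apply: (@le_trans _ _ (\int[@lebesgue2 R]_(x in OmegaL) g x)%E).
  apply: le_integral_ge0 => x.
    by move=> _; apply: integral_ge0 => y _; rewrite lee_fin kernel_bound_ge0.
  move=> [/= ]; rewrite in_itv/= => /andP[_ x0] _.
  rewrite /g ltr0_norm//; exact: integral_majorant_OmegaR.
rewrite ge0_integral_lebesgue2//; last 2 first.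
- apply/measurable_EFinP; apply: measurable_funM => //; apply: measurable_funV.
  apply: measurable_funD => //.
  exact: (@measurableT_comp _ _ _ _ _ _ (@Num.norm _ R)).
- by move=> x; rewrite lee_fin mulr_ge0// invr_ge0 addr_ge0// ltW.
apply: (@le_trans _ _ (\int[lebesgue_measure]_(s in `](-1)%R, 0%R[)
    ((25 * pi)%:E * ((eps - s)^-1)%:E))%E).
  apply: le_integral_ge0 => s.
    move=> _; apply: integral_ge0 => t _.
    by rewrite lee_fin mulr_ge0// invr_ge0 addr_ge0// ltW.
  rewrite /= in_itv/= => /andP[_ s0]; rewrite /g/= integral_cst//.
  have m2 : lebesgue_measure (`](-1)%R, 1%R[ : set R) = 2%:E.
    by rewrite lebesgue_measure_itv/= lte_fin ifT ?opprK//; lra.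
  rewrite [leLHS](_ : _ = (25 / 2 * pi * (eps + `|s|)^-1)%:E * 2%:E)%E.
    by rewrite -!EFinM lee_fin ltr0_norm//; lra.
  by congr (_ * _)%E.
rewrite ge0_integralZl_EFin//.
- have -> : 50 * pi * ln (1 / eps) = 25 * pi * (2 * ln (1 / eps)) :> R by ring.
  rewrite [leRHS]EFinM; apply: lee_wpmul2l; last exact: integral_inv_le.
  by rewrite lee_fin mulr_ge0 ?pi_ge0.
- by move=> s; rewrite /= in_itv/= => /andP[_ s0]; rewrite lee_fin invr_ge0; lra.
- by apply/measurable_EFinP/measurable_funV/measurable_funB.
- by rewrite mulr_ge0 ?pi_ge0.
Qed.

(** The distance condition is spent pointwise on the product of [A] and [B]; once the kernel has
    been replaced by its nonnegative majorant, the domain can be enlarged. *)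
Lemma integral_abs_kernelK_le (R : realType) (eps : R) (A B : set (plane R)) :
  0 < eps -> eps < 1 / 2 -> measurable A -> measurable B ->
  A `<=` OmegaL -> B `<=` OmegaR -> (eps%:E <= set_dist A B)%E ->
  (\int[@lebesgue2 R \x @lebesgue2 R]_(z in A `*` B)
     `|(kernelK `|z.1.1 - z.2.1| (z.1.2 - z.2.2))%:E|
   <= (50 * pi * ln (1 / eps))%:E)%E.
Proof.
move=> e0 e12 mA mB AL BR dAB; apply: le_trans (integral_majorant _ _ e0 e12).
rewrite [leLHS]integral_mkcond [leRHS]integral_mkcond.
apply: le_integral_ge0 => z _; first exact: erestrict_ge0.
rewrite !patchE; case: ifPn => [|_]; rewrite ?inE.
  move=> [Az Bz]; rewrite ifT; last by rewrite inE; split; [exact: AL|exact: BR].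
  rewrite lee_fin; apply: kernelK_le => //.
  have -> : `|z.1.1 - z.2.1| ^+ 2 = (z.1.1 - z.2.1) ^+ 2.
    by rewrite real_normK// num_real.
  by rewrite -lee_fin; apply: le_trans dAB _; apply: ereal_inf_lbound; exists z.
by case: ifPn => // _; rewrite lee_fin kernel_bound_ge0.
Qed.

Lemma maxinteraction_le (R : realType) (eps : R) : 0 < eps -> eps < 1 / 2 ->
  (maxinteraction eps <= (50 * pi * ln (1 / eps))%:E)%E.
Proof.
move=> e0 e12; apply: ge_ereal_sup => _ [A [B [[mA mB] AL BR dAB ->]]].
apply: (le_trans _ (integral_abs_kernelK_le _ _ _ _ e0 e12 mA mB AL BR dAB)).
apply: le_abse_integral; first exact: measurableX.
by apply/measurable_EFinP/measurable_funTS; exact: measurable_kernelK.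
Qed.

(** * Choice of signs and additivity of the interaction *)

(* The signs are chosen greedily, so that each new index has a nonnegative
   total interaction with the earlier ones. *)
Lemma exists_signs_diag_le (R : realDomainType) (I : eqType) (M : I -> I -> R)
    (s : seq I) : uniq s ->
  exists sg : I -> bool, \sum_(i <- s) M i i <=
    \sum_(i <- s) \sum_(j <- s) (-1) ^+ sg i * ((-1) ^+ sg j * M i j).
Proof.
elim: s => [_|a s ih /= /andP[aNs us]]; first by exists xpredT; rewrite !big_nil.
have [sg hsg] := ih us.
(* [X] collects the row and the column of the new index [a], since [M] need not be symmetric. The
   sign [b] turns it into its absolute value, while the diagonal term [M a a] is multiplied by a
   squared sign. *)
pose X := \sum_(j <- s) (-1) ^+ sg j * M a j + \sum_(i <- s) (-1) ^+ sg i * M i a.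
pose b := X < 0; pose sg' i := if i == a then b else sg i.
exists sg'.
have sga : sg' a = b by rewrite /sg' eqxx.
have sgs i : i \in s -> sg' i = sg i.
  by rewrite /sg'; case: eqP => // -> /[!(negbTE aNs)].
have bX : 0 <= (-1) ^+ b * X.
  rewrite /b; case: (ltP X 0) => [X0|X0]; rewrite ?expr1 ?expr0 ?mul1r//.
  by rewrite mulN1r oppr_ge0 ltW.
rewrite !big_cons sga mulrA -expr2 sqrr_sign mul1r -addrA lerD2l.
under [X in _ <= _ + X]eq_bigr do rewrite big_cons.
rewrite big_split/= addrA.
have -> : \sum_(j <- s) (-1) ^+ b * ((-1) ^+ sg' j * M a j) +
  \sum_(i <- s) (-1) ^+ sg' i * ((-1) ^+ sg' a * M i a) = (-1) ^+ b * X.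
  rewrite /X mulrDr !mulr_sumr; congr (_ + _); apply: eq_big_seq => i /sgs ->//.
  by rewrite sga mulrCA.
rewrite ler_wpDl//; apply: le_trans hsg _.
rewrite le_eqVlt; apply/orP; left; apply/eqP; apply: eq_big_seq => i /sgs ->.
by apply: eq_big_seq => j /sgs ->.
Qed.

Lemma sum_sign (R : pzRingType) (I : Type) (s : seq I) (sg : I -> bool)
    (F : I -> R) :
  \sum_(i <- s) (-1) ^+ sg i * F i =
  \sum_(i <- [seq i <- s | ~~ sg i]) F i - \sum_(i <- [seq i <- s | sg i]) F i.
Proof.
rewrite (bigID (fun i => ~~ sg i))/= !big_filter; congr (_ + _).
  by apply: eq_bigr => i /negbTE ->; rewrite expr0 mul1r.
rewrite -sumrN; apply: eq_big => [i|i]; first by rewrite negbK.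
by rewrite negbK => ->; rewrite expr1 mulN1r.
Qed.

(** Splitting both indices by sign turns the signed double sum into four unsigned sums over
    subfamilies, each at most [U] in absolute value. The bound is assumed for all [P] and [Q]
    because the signs are only known to exist. *)
Lemma sum_diag_le (R : realDomainType) (I : eqType) (M : I -> I -> R)
    (s : seq I) (U : R) : uniq s ->
  (forall P Q : pred I,
    `|\sum_(i <- [seq i <- s | P i]) \sum_(j <- [seq j <- s | Q j]) M i j| <= U) ->
  \sum_(i <- s) M i i <= 4 * U.
Proof.
move=> us hU; have [sg /le_trans] := @exists_signs_diag_le _ _ M s us; apply.
under eq_bigr do rewrite -mulr_sumr sum_sign.
rewrite sum_sign !sumrB.
have := hU (fun i => ~~ sg i) (fun i => ~~ sg i); have := hU (fun i => ~~ sg i) sg.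
have := hU sg (fun i => ~~ sg i); have := hU sg sg.
by rewrite !ler_norml => /andP[? ?] /andP[? ?] /andP[? ?] /andP[? ?]; lra.
Qed.

(** A product of two disjoint unions is the disjoint union of the pairwise products, over which the
    integral is additive. *)
Lemma interaction_bigsetU (R : realType) (I : choiceType)
    (A B : I -> set (plane R)) (s t : seq I) :
  (forall i, measurable (A i)) -> (forall i, measurable (B i)) ->
  trivIset setT A -> trivIset setT B -> uniq s -> uniq t ->
  interaction (\big[setU/set0]_(i <- s) A i) (\big[setU/set0]_(j <- t) B j) =
  (\sum_(i <- s) \sum_(j <- t) interaction (A i) (B j))%E.
Proof.
move=> mA mB tA tB us ut; rewrite /interaction.
have -> : \big[setU/set0]_(i <- s) A i `*` \big[setU/set0]_(j <- t) B j =
    \big[setU/set0]_(p <- [seq (i, j) | i <- s, j <- t]) (A p.1 `*` B p.2).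
  rewrite -!bigcup_seq; apply/seteqP; split=> [z [[i /= si Ai] [j /= tj Bj]]|].
    by exists (i, j) => //=; apply/allpairsP; exists (i, j).
  move=> z [_ /= /allpairsP[p [p1 p2 ->]]] [/= Ai Bj].
  by split; [exists p.1|exists p.2].
rewrite integral_bigsetU_EFin.
- by rewrite big_allpairs.
- by move=> p; exact: measurableX.
- by apply: allpairs_uniq => // -[? ?] [? ?].
- move=> p q _ _ [z [[/= Ap Bp] [/= Aq Bq]]].
  rewrite [p]surjective_pairing [q]surjective_pairing; congr (_, _).
    by apply: tA => //; exists z.1.
  by apply: tB => //; exists z.2.
- by apply/measurable_EFinP/measurable_funTS; exact: measurable_kernelK.
Qed.

(** * Whitney rectangles on both sides of the interface *)

(** The shift by one makes the outermost layer, from [d] to [2 * d], end exactly at 1. *)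
Definition dyadic {R : realType} (k : nat) : R := (2 ^+ k.+1)^-1.

(* The pair (k, m) indexes a Whitney rectangle of size and height comparable
   to d = 2^-(k+1) on each side of the interface; the left one lies above the
   right one, so that the kernel is comparable to d^-3 on their product. *)
Definition whitneyL {R : realType} (p : nat * nat) : set (plane R) :=
  let d : R := dyadic p.1 in
  `]- (2 * d), - d] `*` `](p.2%:R + 2 / 3) * d, (p.2%:R + 1) * d[.

Definition whitneyR {R : realType} (p : nat * nat) : set (plane R) :=
  let d : R := dyadic p.1 in
  `[d, 2 * d[ `*` `]p.2%:R * d, (p.2%:R + 1 / 3) * d[.

Lemma dyadic_gt0 (R : realType) k : 0 < dyadic k :> R.
Proof. by rewrite invr_gt0 exprn_gt0. Qed.

Lemma dyadic_lt (R : realType) k l : (k < l)%N -> 2 * dyadic l <= dyadic k :> R.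
Proof.
move=> kl; have -> : 2 * dyadic l = (2 ^+ l)^-1 :> R.
  by rewrite /dyadic exprS invfM mulrA mulfV ?mul1r.
by rewrite lef_pV2 ?posrE ?exprn_gt0// ler_weXn2l// ler1n.
Qed.

(** The distance [t] to the interface determines the layer, by [dyadic_lt]; inside a layer the
    height [v] determines the second index. This serves both sides. *)
Lemma dyadic_index_eq (R : realType) (p q : nat * nat) (t v : R) :
  dyadic p.1 <= t < 2 * dyadic p.1 -> dyadic q.1 <= t < 2 * dyadic q.1 ->
  p.2%:R * dyadic p.1 < v < (p.2%:R + 1) * dyadic p.1 ->
  q.2%:R * dyadic q.1 < v < (q.2%:R + 1) * dyadic q.1 -> p = q.
Proof.
case: p => k m; case: q => l n /= /andP[h1 h2] /andP[h3 h4].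
case: (ltngtP k l) => [kl|lk|-> /andP[h5 h6] /andP[h7 h8]].
- by exfalso; have := dyadic_lt R _ _ kl; lra.
- by exfalso; have := dyadic_lt R _ _ lk; lra.
- have d0 := dyadic_gt0 R l.
  case: (ltngtP m n) => [mn|nm|-> //].
  + have : m%:R + 1 <= n%:R :> R by rewrite natr1 ler_nat.
    by rewrite -(ler_pM2r d0) => mn'; exfalso; lra.
  + have : n%:R + 1 <= m%:R :> R by rewrite natr1 ler_nat.
    by rewrite -(ler_pM2r d0) => mn'; exfalso; lra.
Qed.

Lemma trivIset_whitneyL (R : realType) : trivIset setT (@whitneyL R).
Proof.
move=> p q _ _ [x [[/=]]]; rewrite !in_itv/= => /andP[a1 a2] /andP[a3 a4] [/=].
rewrite !in_itv/= => /andP[b1 b2] /andP[b3 b4].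
have p0 := dyadic_gt0 R p.1; have q0 := dyadic_gt0 R q.1.
(* The left rectangles are closed at [- d], so that [- x.1] falls in the interval closed at [d] and
   open at [2 * d]. *)
by apply: (@dyadic_index_eq R _ _ (- x.1) x.2); apply/andP; split; lra.
Qed.

Lemma trivIset_whitneyR (R : realType) : trivIset setT (@whitneyR R).
Proof.
move=> p q _ _ [x [[/=]]]; rewrite !in_itv/= => /andP[a1 a2] /andP[a3 a4] [/=].
rewrite !in_itv/= => /andP[b1 b2] /andP[b3 b4].
have p0 := dyadic_gt0 R p.1; have q0 := dyadic_gt0 R q.1.
by apply: (@dyadic_index_eq R _ _ x.1 x.2); apply/andP; split; lra.
Qed.

Lemma measurable_whitneyL (R : realType) p : measurable (@whitneyL R p).
Proof. by apply: borel_measurable_plane; exact: measurableX. Qed.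

Lemma measurable_whitneyR (R : realType) p : measurable (@whitneyR R p).
Proof. by apply: borel_measurable_plane; exact: measurableX. Qed.

Lemma lebesgue2_rectangle (R : realType) (i j : interval R) :
  lebesgue2 ([set` i] `*` [set` j] : set (plane R)) =
  (lebesgue_measure [set` i] * lebesgue_measure [set` j])%E.
Proof.
rewrite lebesgue2_borelE; last exact: measurableX.
exact: product_measure1E.
Qed.

Lemma lebesgue2_whitneyL (R : realType) p :
  lebesgue2 (@whitneyL R p) = (dyadic p.1 ^+ 2 / 3)%:E.
Proof.
have d0 := dyadic_gt0 R p.1; rewrite lebesgue2_rectangle !lebesgue_measure_itv/=.
rewrite !lte_fin !ifT; [|by lra..].
by rewrite -!EFinB -EFinM; congr EFin; field.
Qed.

Lemma lebesgue2_whitneyR (R : realType) p :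
  lebesgue2 (@whitneyR R p) = (dyadic p.1 ^+ 2 / 3)%:E.
Proof.
have d0 := dyadic_gt0 R p.1; rewrite lebesgue2_rectangle !lebesgue_measure_itv/=.
rewrite !lte_fin !ifT; [|by lra..].
by rewrite -!EFinB -EFinM; congr EFin; field.
Qed.

(** Here [r ^+ 2 + s ^+ 2 <= 17 * d ^+ 2], so the kernel is at least [(d / 3) / (17 ^+ 2 * d ^+ 4)],
    that is [1 / (867 * d ^+ 3)], and 867 is rounded up to 1000. *)
Lemma kernelK_ge (R : realType) (d r s : R) : 0 < d -> 0 <= r <= 4 * d ->
  d / 3 <= s <= d -> ((10 * d) ^+ 3)^-1 <= kernelK r s.
Proof.
move=> d0 /andP[r0 r4] /andP[s0 s1].
have h : r ^+ 2 + s ^+ 2 <= 17 * d ^+ 2 by nra.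
have h0 : 0 < r ^+ 2 + s ^+ 2 by rewrite ltr_wpDl ?sqr_ge0// exprn_gt0//; lra.
rewrite /kernelK ler_pdivlMr ?exprn_gt0// mulrC ler_pdivrMr ?exprn_gt0 ?mulr_gt0//.
have h2 : (r ^+ 2 + s ^+ 2) ^+ 2 <= (17 * d ^+ 2) ^+ 2.
  by rewrite ler_pXn2r// nnegrE; nra.
have d3 : 0 <= (10 * d) ^+ 3 by rewrite exprn_ge0// mulr_ge0// ltW.
apply: (le_trans h2); apply: (le_trans _ (ler_wpM2r d3 s0)).
have -> : d / 3 * (10 * d) ^+ 3 = 10 ^+ 3 / 3 * d ^+ 4 by field.
have -> : (17 * d ^+ 2) ^+ 2 = 17 ^+ 2 * d ^+ 4 by ring.
by rewrite ler_pM2r ?exprn_gt0//; lra.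
Qed.

(** Two areas [d ^+ 2 / 3] times the kernel bound [1 / (10 * d) ^+ 3] give [d / 9000]. *)
Lemma interaction_whitney_ge (R : realType) p :
  ((dyadic p.1 / 10 ^+ 4)%:E <= interaction (@whitneyL R p) (whitneyR p))%E.
Proof.
have d0 := dyadic_gt0 R p.1.
have mLR : measurable (@whitneyL R p `*` @whitneyR R p).
  by apply: measurableX; [exact: measurable_whitneyL|exact: measurable_whitneyR].
apply: (@le_trans _ _ (\int[@lebesgue2 R \x @lebesgue2 R]_(z in
    whitneyL p `*` whitneyR p) (cst (((10 * dyadic p.1) ^+ 3)^-1)%:E z))%E).
  rewrite integral_cst//.
  rewrite [X in (_ * X)%E]
    (_ : _ = (dyadic p.1 ^+ 2 / 3 * (dyadic p.1 ^+ 2 / 3))%:E).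
    rewrite -EFinM lee_fin; set d := dyadic p.1 in d0 *.
    have -> : ((10 * d) ^+ 3)^-1 * (d ^+ 2 / 3 * (d ^+ 2 / 3)) =
        d / (9 * 10 ^+ 3) by field; rewrite gt_eqF.
    by rewrite ler_pM2l// lef_pV2 ?posrE; lra.
  transitivity (lebesgue2 (@whitneyL R p) * lebesgue2 (@whitneyR R p))%E.
    apply: product_measure1E; first exact: measurable_whitneyL.
    exact: measurable_whitneyR.
  by rewrite lebesgue2_whitneyL lebesgue2_whitneyR -EFinM.
apply: le_integral_ge0 => z.
  by move=> _; rewrite lee_fin invr_ge0 exprn_ge0// mulr_ge0// ltW.
move=> [[/=]]; rewrite !in_itv/= => /andP[a1 a2] /andP[a3 a4] [/=].
rewrite !in_itv/= => /andP[b1 b2] /andP[b3 b4].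
rewrite lee_fin; apply: kernelK_ge => //; last by apply/andP; split; lra.
by rewrite normr_ge0/= ltr0_norm; lra.
Qed.

Lemma double_dyadic_le1 (R : realType) k : 2 * dyadic k <= 1 :> R.
Proof.
rewrite /dyadic exprS invfM mulrA mulfV ?mul1r// invf_le1 ?exprn_gt0//.
by rewrite exprn_ege1// ler1n.
Qed.

Lemma dyadic_index_le1 (R : realType) k m : (m < 2 ^ k.+1)%N ->
  (m%:R + 1) * dyadic k <= 1 :> R.
Proof.
by move=> m2; rewrite /dyadic ler_pdivrMr ?exprn_gt0// mul1r natr1 -natrX ler_nat.
Qed.

Lemma whitneyL_sub (R : realType) p : (p.2 < 2 ^ p.1.+1)%N ->
  @whitneyL R p `<=` OmegaL.
Proof.
move=> m2 x [/=]; rewrite !in_itv/= => /andP[a1 a2] /andP[a3 a4].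
have d0 := dyadic_gt0 R p.1; have d1 := double_dyadic_le1 R p.1.
have md := dyadic_index_le1 R _ _ m2.
have m0 : 0 <= (p.2%:R + 2 / 3) * dyadic p.1 :> R.
  by rewrite mulr_ge0 ?addr_ge0// ltW.
by split => /=; rewrite in_itv/=; apply/andP; split; lra.
Qed.

Lemma whitneyR_sub (R : realType) p : (p.2 < 2 ^ p.1.+1)%N ->
  @whitneyR R p `<=` OmegaR.
Proof.
move=> m2 x [/=]; rewrite !in_itv/= => /andP[a1 a2] /andP[a3 a4].
have d0 := dyadic_gt0 R p.1; have d1 := double_dyadic_le1 R p.1.
have md := dyadic_index_le1 R _ _ m2.
have m0 : 0 <= p.2%:R * dyadic p.1 :> R by rewrite mulr_ge0// ltW.
by split => /=; rewrite in_itv/=; apply/andP; split; lra.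
Qed.

(** * Families of rectangles and the lower bound *)

(** Layer [k] has [2 ^ k.+1] indices, the inverse of [dyadic k]: the rectangles reach at most height
    1, and the sizes in one layer add up to 1. *)
Definition whitney_indices (N : nat) : seq (nat * nat) :=
  [seq (k, m) | k <- iota 0 N, m <- iota 0 (2 ^ k.+1)].

Lemma mem_whitney_indices N p :
  (p \in whitney_indices N) = (p.1 < N)%N && (p.2 < 2 ^ p.1.+1)%N.
Proof.
apply/allpairsPdep/idP => [[k [m [kN mk ->]]]|/andP[kN mk]].
  by move: kN mk; rewrite !mem_iota/= !add0n => -> ->.
by exists p.1, p.2; rewrite !mem_iota/= !add0n kN mk -surjective_pairing.
Qed.

Lemma whitney_indices_uniq N : uniq (whitney_indices N).
Proof.
apply: allpairs_uniq_dep; rewrite ?iota_uniq//.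
  by move=> k _; exact: iota_uniq.
by move=> [k m] [l n] _ _ [-> ->].
Qed.

Lemma sum_dyadic_whitney_indices (R : realType) N :
  \sum_(p <- whitney_indices N) dyadic p.1 = N%:R :> R.
Proof.
rewrite big_allpairs_dep/= (eq_bigr (fun=> 1)) => [|k _].
  by rewrite big_const_seq count_predT size_iota iter_addr_0.
rewrite big_const_seq count_predT size_iota iter_addr_0.
by rewrite -mulr_natr natrX mulVf// gt_eqF// exprn_gt0.
Qed.

(** A left point of layer [k] and a right point of layer [l] are horizontally at least
    [dyadic k + dyadic l] apart, and each term is at least [eps / 2]; any two subfamilies are
    therefore admissible. *)
Lemma interaction_whitney_le (R : realType) (eps : R) N
    (s t : seq (nat * nat)) :
  (forall k, (k < N)%N -> eps <= 2 * dyadic k) ->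
  {subset s <= whitney_indices N} -> {subset t <= whitney_indices N} ->
  (`|interaction (\big[setU/set0]_(p <- s) @whitneyL R p)
                 (\big[setU/set0]_(p <- t) @whitneyR R p)|
   <= maxinteraction eps)%E.
Proof.
move=> he sN tN; set A := \big[setU/set0]_(p <- s) _.
set B := \big[_/_]_(p <- t) _.
have AL : A `<=` OmegaL.
  rewrite /A -bigcup_seq => x [p /= /sN]; rewrite mem_whitney_indices.
  by move=> /andP[_ h]; exact: whitneyL_sub.
have BR : B `<=` OmegaR.
  rewrite /B -bigcup_seq => x [p /= /tN]; rewrite mem_whitney_indices.
  by move=> /andP[_ h]; exact: whitneyR_sub.
have dAB : (eps%:E <= set_dist A B)%E.
  apply: le_ereal_inf_tmp => _ [z [+ +] <-].
  rewrite /A /B -!bigcup_seq => -[p /= /sN + [+ _]] [q /= /tN + [+ _]].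
  rewrite !mem_whitney_indices /= !in_itv/=.
  move=> /andP[/he ep _] /andP[_ zp] /andP[/he eq _] /andP[zq _].
  have h : eps <= z.2.1 - z.1.1 by lra.
  rewrite lee_fin; apply: (le_trans h); apply: (le_trans (ler_norm _)).
  by rewrite -sqrtr_sqr ler_sqrt ?addr_ge0 ?sqr_ge0// -sqrrN opprB lerDl sqr_ge0.
apply: ereal_sup_ubound; exists A, B; split => //; split.
- by apply: bigsetU_measurable => p _; exact: measurable_whitneyL.
- by apply: bigsetU_measurable => p _; exact: measurable_whitneyR.
Qed.

(** The interactions form a matrix [M] whose trace is at least [N / 10 ^+ 4], while [sum_diag_le]
    bounds the trace by four times [maxinteraction eps]. *)
Lemma maxinteraction_ge (R : realType) (eps : R) N : 0 < eps -> eps < 1 / 2 ->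
  (forall k, (k < N)%N -> eps <= 2 * dyadic k) ->
  ((N%:R / (4 * 10 ^+ 4))%:E <= maxinteraction eps)%E.
Proof.
move=> e0 e12 he.
(* Finiteness, inherited from the upper bound, is what allows passing to the real matrix [M]. *)
have finI s t : {subset s <= whitney_indices N} ->
    {subset t <= whitney_indices N} ->
    interaction (\big[setU/set0]_(p <- s) @whitneyL R p)
                (\big[setU/set0]_(p <- t) @whitneyR R p) \is a fin_num.
  move=> sN tN; have h := @interaction_whitney_le R eps N s t he sN tN.
  rewrite -abse_fin_num ge0_fin_numE//; apply: le_lt_trans h _.
  exact: le_lt_trans (maxinteraction_le _ _ e0 e12) (ltry _).
pose M p q : R := fine (interaction (whitneyL p) (whitneyR q)).
have ME p q : p \in whitney_indices N -> q \in whitney_indices N ->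
    interaction (whitneyL p) (whitneyR q) = (M p q)%:E.
  move=> pN qN; rewrite /M fineK//.
  have := finI [:: p] [:: q]; rewrite !big_seq1; apply.
    by move=> r; rewrite inE => /eqP ->.
  by move=> r; rewrite inE => /eqP ->.
have hU (P Q : pred (nat * nat)) :
    (`|\sum_(p <- [seq p <- whitney_indices N | P p])
       \sum_(q <- [seq q <- whitney_indices N | Q q]) M p q|%:E
     <= maxinteraction eps)%E.
  have sP : {subset [seq p <- whitney_indices N | P p] <= whitney_indices N}.
    by move=> p; rewrite mem_filter => /andP[].
  have sQ : {subset [seq q <- whitney_indices N | Q q] <= whitney_indices N}.
    by move=> q; rewrite mem_filter => /andP[].
  have := @interaction_whitney_le R eps N _ _ he sP sQ.
  rewrite interaction_bigsetU.
  - rewrite (_ : (\sum_(i <- _) _)%E =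
        (\sum_(p <- [seq p <- whitney_indices N | P p])
         \sum_(q <- [seq q <- whitney_indices N | Q q]) M p q)%:E)//.
    rewrite -sumEFin; apply: eq_big_seq => p /sP pN.
    by rewrite -sumEFin; apply: eq_big_seq => q /sQ qN; exact: ME.
  - exact: measurable_whitneyL.
  - exact: measurable_whitneyR.
  - exact: trivIset_whitneyL.
  - exact: trivIset_whitneyR.
  - by rewrite filter_uniq// whitney_indices_uniq.
  - by rewrite filter_uniq// whitney_indices_uniq.
have Ufin : maxinteraction eps \is a fin_num.
  rewrite ge0_fin_numE; last by apply: le_trans (hU xpred0 xpred0); rewrite lee_fin.
  exact: le_lt_trans (maxinteraction_le _ _ e0 e12) (ltry _).
rewrite -(fineK Ufin) lee_fin.
have := @sum_diag_le R _ M _ (fine (maxinteraction eps)) (whitney_indices_uniq N).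
have hU' P Q : `|\sum_(p <- [seq p <- whitney_indices N | P p])
       \sum_(q <- [seq q <- whitney_indices N | Q q]) M p q|
     <= fine (maxinteraction eps) by rewrite -lee_fin fineK.
move=> /(_ hU').
have : N%:R / 10 ^+ 4 <= \sum_(p <- whitney_indices N) M p p.
  rewrite -(@sum_dyadic_whitney_indices R) mulr_suml.
  rewrite big_seq [leRHS]big_seq; apply: ler_sum => p pN.
  by rewrite -lee_fin -ME//; exact: interaction_whitney_ge.
by lra.
Qed.

(** Take the least [N] with [1 / eps < 2 ^+ N]: minimality yields the condition on each [k < N], and
    [ln (1 / eps) <= N * ln 2]. *)
Lemma exists_dyadic_scale (R : realType) (eps : R) : 0 < eps -> eps < 1 / 2 ->
  exists2 N : nat, (forall k, (k < N)%N -> eps <= 2 * dyadic k) &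
    ln (1 / eps) <= N%:R.
Proof.
move=> e0 e12.
have [n0 n0P] : exists n, 1 / eps < 2 ^+ n.
  exists (Num.truncn (1 / eps)).+1; apply: lt_trans (truncnS_gt _) _.
  by rewrite -natrX ltr_nat ltn_expl.
case: (ex_minnP (ex_intro (fun n => 1 / eps < 2 ^+ n) n0 n0P)) => N hN minN.
exists N => [k kN|].
  have : 2 ^+ k <= 1 / eps.
    by rewrite leNgt; apply/negP => /minN; rewrite leqNgt kN.
  rewrite /dyadic exprS invfM mulrA mulfV// mul1r div1r => h.
  by rewrite -[eps]invrK lef_pV2 ?posrE ?invr_gt0 ?exprn_gt0.
apply: (@le_trans _ _ (ln (2 ^+ N))).
  by rewrite ler_ln ?posrE ?divr_gt0 ?exprn_gt0// ltW.
rewrite lnXn// lerMn2r; apply/orP; right.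
(* [ln 2 <= 1], from [ln (1 + x) <= x] at [x = 1]. *)
by have := @le_ln1Dx R 1; rewrite -[1 + 1]/2; apply; lra.
Qed.

Theorem proposition6p1 (R : realType) :
  exists c C : R, [/\ 0 < c, c <= C &
    forall eps : R, 0 < eps -> eps < 1 / 2 ->
      ((c * ln (1 / eps))%:E <= maxinteraction eps)%E /\
      (maxinteraction eps <= (C * ln (1 / eps))%:E)%E].
Proof.
exists (4 * 10 ^+ 4)^-1, (50 * pi); split.
- by rewrite invr_gt0 mulr_gt0 ?exprn_gt0.
(* The constants are ordered because the first is at most 1 and [pi] is at least 2. *)
- have : (4 * 10 ^+ 4)^-1 <= 1 :> R by rewrite invf_le1; lra.
  by have := pi_ge2 R; lra.
- move=> eps e0 e12; split; last exact: maxinteraction_le.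
  have [N he lnN] := exists_dyadic_scale _ _ e0 e12.
  apply: le_trans (maxinteraction_ge _ _ _ e0 e12 he).
  by rewrite lee_fin mulrC ler_pM2r// invr_gt0 mulr_gt0 ?exprn_gt0.
Qed.
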